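(* Let $d\in\{1,2,3,\dots\}$. There exists a constant $C=C(d)>0$, depending only on $d$, such that for every $\alpha\in(0,1)$ and every $\varphi\in C_c^\infty(\mathbb{R}^d)$, $$\int_{\mathbb{R}^d}|\varphi|\,d\mathcal{H}^{d-\alpha}_\infty\le C\,\alpha(1-\alpha)\,[\varphi]_{W^{\alpha,1}(\mathbb{R}^d)}.$$
   Context: For $s>0$ and $A\subset\mathbb{R}^d$, the Hausdorff content of dimension $s$ is $$\mathcal{H}^s_\infty(A):=\inf\Big\{\sum_{i=0}^\infty\omega_s r_i^s: A\subset\bigcup_{i=0}^\infty B_{r_i}(x_i)\Big\},\qquad \omega_s:=\frac{\pi^{s/2}}{\Gamma(\frac s2+1)},$$ where the infimum is over countable coverings by open balls (finite coverings allowed). The Choquet integral is $$\int_{\mathbb{R}^d}|u|\,d\mathcal{H}^s_\infty:=\int_0^\infty\mathcal{H}^s_\infty(\{|u|>t\})\,dt.$$ For $\alpha\in(0,1)$, the Gagliardo seminorm is $$[u]_{W^{\alpha,1}(\mathbb{R}^d)}:=\int_{\mathbb{R}^d}\int_{\mathbb{R}^d}\frac{|u(y)-u(z)|}{|y-z|^{\alpha+d}}\,dy\,dz.$$ *)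

(* Defs.v *)
From HB Require Import structures.
From mathcomp Require Import all_boot all_order all_algebra.
From mathcomp Require Import all_classical all_reals all_analysis.

Set Implicit Arguments.
Unset Strict Implicit.
Unset Printing Implicit Defensive.
Import Order.TTheory GRing.Theory Num.Theory.
Import numFieldTopology.Exports numFieldNormedType.Exports.
Local Open Scope classical_set_scope.
Local Open Scope ring_scope.

(* R^n is 'rV[R]_n. Its library norm is the sup norm: only the topology and
   the derivatives, which do not depend on the choice of a norm, come from it.
   Distances and balls are Euclidean, via [enorm]. *)

Section euclidean.
Context {R : realType} {n : nat}.
Implicit Types x : 'rV[R]_n.

Definition enorm x : R := Num.sqrt (\sum_(i < n) x ord0 i ^+ 2).

Definition eball x (r : R) : set 'rV[R]_n := [set y | enorm (y - x) < r].

End euclidean.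

(* The measurable sets of 'rV[R]_n are those of the product sigma-algebra,
   which is the Borel sigma-algebra of R^n. *)

Definition rV_display : measure_display.
Proof. exact: default_measure_display. Qed.

Section measurable_rV.
Context {R : realType} (n : nat).

Definition rV_coord (i : 'I_n) (x : 'rV[R]_n) : measurableTypeR R := x ord0 i.

Let rV_set0 : g_sigma_preimage rV_coord set0.
Proof. exact: sigma_algebra0. Qed.

Let rV_setC A : g_sigma_preimage rV_coord A -> g_sigma_preimage rV_coord (~` A).
Proof. exact: sigma_algebraC. Qed.

Let rV_bigcup (F : _^nat) : (forall i, g_sigma_preimage rV_coord (F i)) ->
  g_sigma_preimage rV_coord (\bigcup_i (F i)).
Proof. exact: sigma_algebra_bigcup. Qed.

HB.instance Definition _ := @isMeasurable.Build rV_display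
  'rV[R]_n (g_sigma_preimage rV_coord) rV_set0 rV_setC rV_bigcup.

End measurable_rV.

Lemma measurable_rV_coord {R : realType} n (i : 'I_n) :
  measurable_fun [set: 'rV[R]_n] (rV_coord i).
Proof.
move=> _ A mA; apply: sub_sigma_algebra.
by rewrite (bigD1 i) //=; left; exists A.
Qed.

Lemma measurable_fun_rV {R : realType} n d (T : measurableType d)
    (f : T -> 'rV[R]_n) :
  (forall i, measurable_fun [set: T] (rV_coord i \o f)) ->
  measurable_fun [set: T] f.
Proof.
move=> mf _ A mA; rewrite setTI.
suff : image_set_system [set: T] f measurable A.
  by rewrite /image_set_system /= setTI.
move: A mA; apply: smallest_sub.
  exact/sigma_algebra_image/sigma_algebra_measurable.
apply: (big_ind (fun C => C `<=` image_set_system [set: T] f measurable)).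
- by move=> ? [].
- by move=> C D CS DS A [/CS|/DS].
- move=> i _ _ [B mB <-]; rewrite /image_set_system /= !setTI.
  by have := mf i measurableT B mB; rewrite setTI.
Qed.

Section rV_cons.
Context {R : realType} (n : nat).

Definition rV_cons (p : measurableTypeR R * 'rV[R]_n) : 'rV[R]_n.+1 :=
  \row_(i < n.+1) if unlift ord0 i is Some j then p.2 ord0 j else p.1.

Definition rV_uncons (x : 'rV[R]_n.+1) : measurableTypeR R * 'rV[R]_n :=
  (x ord0 ord0, \row_(i < n) x ord0 (lift ord0 i)).

Lemma rV_consK : cancel rV_cons rV_uncons.
Proof.
move=> [a x]; rewrite /rV_uncons mxE unlift_none; congr pair.
by apply/rowP => i; rewrite !mxE liftK.
Qed.

Lemma measurable_rV_cons : measurable_fun [set: _] rV_cons.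
Proof.
apply: measurable_fun_rV => i.
rewrite (_ : _ \o _ = fun p : measurableTypeR R * 'rV[R]_n =>
    if unlift ord0 i is Some j then rV_coord j p.2 else p.1); last first.
  by apply/funext => p; rewrite /= /rV_coord mxE.
case: (unlift ord0 i) => [j|]; last exact: measurable_fst.
by apply: measurableT_comp; [exact: measurable_rV_coord|exact: measurable_snd].
Qed.

Lemma measurable_rV_uncons : measurable_fun [set: _] rV_uncons.
Proof.
apply/measurable_fun_pairP; split => /=; first exact: (measurable_rV_coord ord0).
apply: measurable_fun_rV => i.
rewrite (_ : _ \o _ = rV_coord (lift ord0 i)).
  exact: measurable_rV_coord.
by apply/funext => x; rewrite /= /rV_coord mxE.
Qed.

End rV_cons.

(* One-dimensional Lebesgue measure times mu, transported to 'rV[R]_n.+1. *)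

Section lebesgue_rVS.
Context {R : realType} {n : nat}.
Variable mu : {sigma_finite_measure set 'rV[R]_n -> \bar R}.

Definition lebesgue_rVS : set 'rV[R]_n.+1 -> \bar R :=
  pushforward (@lebesgue_measure R \x mu)%E (@rV_cons R n).

Let lebesgue_rVS0 : lebesgue_rVS set0 = 0%E.
Proof. by rewrite /lebesgue_rVS /pushforward preimage_set0 measure0. Qed.

Let lebesgue_rVS_ge0 A : (0 <= lebesgue_rVS A)%E.
Proof. by rewrite /lebesgue_rVS /pushforward; exact: measure_ge0. Qed.

Let mcons A : measurable A -> measurable (@rV_cons R n @^-1` A).
Proof.
by move=> mA; rewrite -[X in measurable X]setTI; exact: measurable_rV_cons.
Qed.

Let lebesgue_rVS_sigma_additive : semi_sigma_additive lebesgue_rVS.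
Proof.
move=> F mF tF mUF; rewrite /lebesgue_rVS /pushforward preimage_bigcup.
apply: measure_semi_sigma_additive.
- by move=> i; exact: mcons.
- apply/trivIsetP => /= i j _ _ ij; rewrite -preimage_setI.
  by move/trivIsetP : tF => /(_ _ _ _ _ ij) ->//; rewrite preimage_set0.
- by rewrite -preimage_bigcup; exact: mcons.
Qed.

HB.instance Definition _ := isMeasure.Build _ _ _ lebesgue_rVS
  lebesgue_rVS0 lebesgue_rVS_ge0 lebesgue_rVS_sigma_additive.

Let lebesgue_rVS_sigma_finite : sigma_finite [set: 'rV[R]_n.+1] lebesgue_rVS.
Proof.
have [F TF Foo] := sigma_finiteT (@lebesgue_measure R).
have [G TG Goo] := sigma_finiteT mu.
pose p k : nat * nat := odflt (0, 0)%N (unpickle k).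
have pE ij : p (pickle ij) = ij by rewrite /p pickleK.
exists (fun k => @rV_uncons R n @^-1` (F (p k).1 `*` G (p k).2)).
  apply/esym; rewrite -subTset => x _.
  have [i _ Fi] : (\bigcup_i F i) (rV_uncons x).1 by rewrite -TF.
  have [j _ Gj] : (\bigcup_i G i) (rV_uncons x).2 by rewrite -TG.
  by exists (pickle (i, j)) => //=; rewrite pE.
move=> k; have [mF Fk] := Foo (p k).1; have [mG Gk] := Goo (p k).2.
split.
  rewrite -[X in measurable X]setTI; apply: measurable_rV_uncons => //.
  exact: measurableX.
rewrite /lebesgue_rVS /pushforward -comp_preimage (_ : _ \o _ = id); last first.
  by apply/funext => q /=; rewrite rV_consK.
by rewrite preimage_id product_measure1E// lte_mul_pinfty// ge0_fin_numE.
Qed.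

HB.instance Definition _ := Measure_isSigmaFinite.Build _ _ _ lebesgue_rVS
  lebesgue_rVS_sigma_finite.

End lebesgue_rVS.

Fixpoint lebesgue_rV (R : realType) (n : nat) :
    {sigma_finite_measure set 'rV[R]_n -> \bar R} :=
  match n with
  | 0 => @dirac _ 'rV[R]_0 0 R
  | m.+1 => lebesgue_rVS (lebesgue_rV R m)
  end.

Lemma lebesgue_rV_box (R : realType) n (A : 'I_n -> set (measurableTypeR R)) :
  (forall i, measurable (A i)) ->
  lebesgue_rV R n [set x | forall i, A i (x ord0 i)] =
  (\prod_(i < n) (@lebesgue_measure R) (A i))%E.
Proof.
elim: n A => [|n IH] A mA.
  rewrite big_ord0 /= diracE mem_set //=; by case.
rewrite big_ord_recl /= /lebesgue_rVS /pushforward.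
rewrite -(IH (fun i => A (lift ord0 i))) //.
rewrite -product_measure1E //; last first.
  rewrite [X in measurable X](_ : _ = \bigcap_(i in [set: 'I_n]) (@rV_coord R n i @^-1`
      A (lift ord0 i))).
    apply: fin_bigcap_measurable => // i _; rewrite -[X in measurable X]setTI.
    exact: measurable_rV_coord.
  by apply/seteqP; split => [x h i _|x h i]; apply: h.
congr ((_ \x _)%E _).
apply/seteqP; split => [[a x]/= h|[a x] /= [h1 h2] i].
  split; first by have := h ord0; rewrite mxE unlift_none.
  by move=> i; have := h (lift ord0 i); rewrite mxE liftK.
by rewrite mxE; case: unliftP => [j ->|->] //=; apply: h2.
Qed.

Section smooth.
Context {R : realType} {n : nat}.
Implicit Types f : 'rV[R]_n -> R.

Definition partial (i : 'I_n) f : 'rV[R]_n -> R :=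
  fun x => 'D_(delta_mx ord0 i) f x.

Definition smooth f := forall s : seq 'I_n,
  continuous (foldr partial f s) /\
  forall i x, derivable (foldr partial f s) x (delta_mx ord0 i).

Definition compact_support f := compact (closure [set x | f x != 0]).

End smooth.

Section hausdorff_content.
Context {R : realType} {n : nat}.
Local Open Scope ereal_scope.

Definition Gamma (x : R) : R :=
  (\int[lebesgue_measure]_(t in `]0, +oo[) (t `^ (x - 1) * expR (- t)))%R.

Definition omega (s : R) : R := (pi `^ (s / 2) / Gamma (s / 2 + 1))%R.

(* The radius 0 is allowed: the ball is then empty and, as s > 0, it does not
   contribute to the sum, so that finite coverings are included. *)
Definition hausdorff_content (s : R) (A : set 'rV[R]_n) : \bar R :=
  ereal_inf [set v | exists x : nat -> 'rV[R]_n, exists r : nat -> R,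
    [/\ forall i, (0 <= r i)%R,
        A `<=` \bigcup_i eball (x i) (r i) &
        v = \sum_(0 <= i <oo) (omega s * r i `^ s)%:E]].

Definition choquet_integral (s : R) (u : 'rV[R]_n -> R) : \bar R :=
  \int[lebesgue_measure]_(t in `[0%R, +oo[)
    hausdorff_content s [set x | (t < `|u x|)%R].

(* For y = z the integrand is 0, since x / 0 = 0. *)
Definition gagliardo (alpha : R) (u : 'rV[R]_n -> R) : \bar R :=
  \int[lebesgue_rV R n]_z \int[lebesgue_rV R n]_y
    (`|u y - u z| / enorm (y - z) `^ (alpha + n%:R))%:E.

End hausdorff_content.

(* Main.v *)
Require Import Defs.
From HB Require Import structures.
From mathcomp Require Import all_boot all_order all_algebra.
From mathcomp Require Import all_classical all_reals all_analysis.
From mathcomp Require Import measurable_realfun ring lra.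
(** The estimate is a boxing inequality for superlevel sets, integrated over the
levels.

Write K for the kernel [|y - z|^-(alpha + d)] and, for an open set E of finite
measure, P(E) for the integral of K over pairs (z, y) with z in E and y outside
E.  The boxing inequality [boxing] says that the content of E of dimension
[d - alpha] is at most [C alpha (1 - alpha) P(E)].  Applied to
[E_t = {|phi| > t}] and integrated in t, it gives the theorem: by Tonelli, the
integral over t of [P(E_t)] is the integral of [K(z, y) (|phi z| - |phi y|)^+],
which the Gagliardo seminorm dominates ([coarea_ge]).

For the boxing inequality, fix a dyadic grid and cover E by the maximal grid
cubes Q in which E has density at least [theta = 2^-(d+1)].  They exist around
each point of E, because E is open and of finite measure, and being maximal they
are disjoint.  As the parent of Q has density below theta, Q itself has density
below [2^d theta = 1/2], and so have its ancestors.  Since balls of radius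
[(d+1) l] centred in cubes Q of side l cover E, and the cubes are disjoint, it
suffices to bound [l^(d-alpha)] by [C alpha (1 - alpha) P_Q], where [P_Q] is the
part of P(E) with z in Q ([cube_interaction_ge]); the normalizing constants of
the contents are bounded uniformly in alpha ([omega_le]).  The factors alpha and
[1 - alpha] come from two regimes.

- Long range.  Each ancestor of Q, of side [2^k l], contains at least
  [(2^k l)^d / 2] of the complement of E, and contributes a multiple of
  [2^(-k alpha) l^(d-alpha)] to [P_Q].  The sum over k is of order [1 / alpha]
  ([far_interaction]).
- Short range.  Let I(rho) be the measure of the pairs z in E, y outside E, both
  in Q, at distance less than rho.  The midpoint of such a pair lies either in E
  or outside it, hence forms with y or with z a pair of the same kind at half
  the distance; so [I(rho) <= 2^(d+1) I(rho / 2)] ([close_pairs_halving]).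
  Starting from a rho beyond the diameter of Q, where I is the product of the
  measures of the two parts of Q, the scale [2^-k] contributes a multiple of
  [2^(-k (1 - alpha)) l^(d-alpha)], and the sum is of order [1 / (1 - alpha)]
  ([near_interaction]).

In both regimes K is replaced by a sum over dyadic scales ([layer_cake]). *)

Import Order.TTheory GRing.Theory Num.Theory.
Import numFieldTopology.Exports numFieldNormedType.Exports.
Local Open Scope ring_scope.

(** * Monotonicity of integrals *)

Section integral_monotone.
Local Open Scope ereal_scope.
Local Open Scope classical_set_scope.

(** The integral of a nonnegative function is a supremum over the simple functions
below it, so comparing integrals needs no measurability.  This is what allows
the content of superlevel sets to be bounded before anything is known about it
as a function of the level. *)
Lemma ge0_le_integral_pointwise d (T : measurableType d) (R : realType)
    (mu : {measure set T -> \bar R}) (D : set T) (f g : T -> \bar R) :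
  (forall x, D x -> 0 <= f x) -> (forall x, D x -> f x <= g x) ->
  \int[mu]_(x in D) f x <= \int[mu]_(x in D) g x.
Proof.
move=> f0 fg; have g0 x : D x -> 0 <= g x.
  by move=> Dx; exact: le_trans (f0 x Dx) (fg x Dx).
rewrite !ge0_integralE//; apply: le_ereal_sup => _ [h hf <-]; exists h => // x.
apply: (le_trans (hf x)); rewrite !patchE; case: ifPn => // xD.
by apply: fg; rewrite inE in xD.
Qed.

End integral_monotone.

(** * Affine changes of variables *)

Section affine.
Local Open Scope ereal_scope.
Local Open Scope classical_set_scope.
Context {R : realType}.

Lemma measurable_fun_affine (a c : R) :
  measurable_fun [set: measurableTypeR R]
    (fun x : measurableTypeR R => (c * x + a)%R : measurableTypeR R).
Proof.
apply: measurable_funD; last exact: measurable_cst.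
by apply: measurable_funM; [exact: measurable_cst|exact: measurable_id].
Qed.

(** By uniqueness of Lebesgue measure it suffices to compare both sides on
intervals. *)
Lemma lebesgue_measure_affine (a : R) (c : {posnum R}) (A : set (measurableTypeR R)) :
  measurable A ->
  lebesgue_measure A =
  c%:num%:E * (pushforward lebesgue_measure
    (fun x : measurableTypeR R => (c%:num * x + a)%R : measurableTypeR R)) A.
Proof.
move=> mA.
have ca := measurable_fun_affine a c%:num.
pose nu := measure_function_pushforward__canonical__measure_function_Measure
  (@lebesgue_measure R) ca.
transitivity (mscale (c%:num%:nng)%R nu A) => //.
apply: lebesgue_measure_unique => //=.
move=> _ [[u v]] _ <- /=; rewrite /mscale /= /pushforward.
have -> : (fun x : measurableTypeR R => (c%:num * x + a)%R : measurableTypeR R) @^-1`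
   `]u, v] = `]((u - a) / c%:num)%R, ((v - a) / c%:num)%R]%classic.
  apply/seteqP; split => x /=; rewrite !in_itv/= => /andP[h1 h2]; apply/andP; split.
  - by rewrite ltr_pdivrMr//; lra.
  - by rewrite ler_pdivlMr//; lra.
  - by move: h1; rewrite ltr_pdivrMr//; lra.
  - by move: h2; rewrite ler_pdivlMr//; lra.
rewrite !lebesgue_measure_itv/= !lte_fin ltr_pM2r// ltrD2r.
case: ifPn => _; last by rewrite mule0.
by rewrite -!EFinB -EFinM; congr EFin; field.
Qed.

Lemma ge0_integral_affine (a : R) (c : {posnum R}) (g : measurableTypeR R -> \bar R) :
  measurable_fun setT g -> (forall x, 0 <= g x) ->
  \int[lebesgue_measure]_x g x =
  c%:num%:E * \int[lebesgue_measure]_x g (c%:num * x + a)%R.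
Proof.
move=> mg g0.
pose nu := measure_function_pushforward__canonical__measure_function_Measure
  (@lebesgue_measure R) (measurable_fun_affine a c%:num).
transitivity (\int[mscale (c%:num%:nng)%R nu]_x g x).
  by apply: eq_measure_integral => A mA _; exact: lebesgue_measure_affine.
rewrite ge0_integral_mscale//=; congr *%E.
rewrite (ge0_integral_pushforward (measurable_fun_affine a c%:num))//.
Qed.

Lemma measurable_fun_rV_affine n (a : 'rV[R]_n) (c : R) :
  measurable_fun setT (fun x : 'rV[R]_n => (c *: x + a)%R).
Proof.
apply: measurable_fun_rV => i.
rewrite (_ : _ \o _ = (fun x : measurableTypeR R =>
    (c * x + a ord0 i)%R : measurableTypeR R) \o rV_coord i).
  by apply: measurableT_comp; [exact: measurable_fun_affine|exact: measurable_rV_coord].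
by apply/funext => x /=; rewrite /rV_coord !mxE.
Qed.

(** Induction on the dimension: the sections of the preimage are the preimages of
the sections, and the one-dimensional case handles the first coordinate. *)
Lemma lebesgue_rV_affine n (a : 'rV[R]_n) (c : {posnum R}) (A : set 'rV[R]_n) :
  measurable A ->
  lebesgue_rV R n A = (c%:num ^+ n)%:E *
    lebesgue_rV R n ((fun x : 'rV[R]_n => (c%:num *: x + a)%R) @^-1` A).
Proof.
elim: n a A => [|n IH] a A mA.
  rewrite expr0 mul1e; congr (lebesgue_rV R 0 _).
  by apply/seteqP; split => x /=; rewrite (_ : (_ + _)%R = x)//;
    rewrite (thinmx0 x) (thinmx0 (_ + _)%R).
have mcons (B : set 'rV[R]_n.+1) : measurable B -> measurable (@rV_cons R n @^-1` B).
  by move=> mB; rewrite -[X in measurable X]setTI; exact: measurable_rV_cons.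
rewrite /= /lebesgue_rVS /pushforward /product_measure1/=.
pose a' := (\row_(i < n) a ord0 (lift ord0 i))%R.
pose g x := lebesgue_rV R n (xsection (@rV_cons R n @^-1` A) x).
have mg : measurable_fun [set: measurableTypeR R] g.
  exact: measurable_fun_xsection (mcons _ mA).
rewrite (ge0_integral_affine (a ord0 ord0) c g mg)//.
rewrite exprS EFinM -muleA; congr *%E.
rewrite -ge0_integralZl//; last first.
  apply: (measurable_fun_xsection (lebesgue_rV R n)); apply: mcons.
  rewrite -[X in measurable X]setTI; exact: measurable_fun_rV_affine.
apply: eq_integral => x _ /=; rewrite /g (IH a'); last first.
  by apply: measurable_xsection; exact: mcons.
congr (_ * lebesgue_rV R n _); apply/seteqP.
have E y : rV_cons ((c%:num * x + a ord0 ord0)%R : measurableTypeR R,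
    (c%:num *: y + a')%R) = (c%:num *: rV_cons (x, y) + a)%R.
  by apply/rowP => i; rewrite !mxE; case: unliftP => [j ->|->] //=; rewrite !mxE.
by split => y; rewrite /xsection /= !inE /= E.
Qed.

End affine.

(** * Grids of cubes *)

Section cubes.
Local Open Scope classical_set_scope.
Context {R : realType} {n : nat}.
Implicit Types (l : R) (x y : 'rV[R]_n).

(** Half-open cells, indexed by integer vectors: for each side [l] they partition
the space. *)
Definition cell l (m : {ffun 'I_n -> int}) : set 'rV[R]_n :=
  [set y | forall i, Num.floor (y ord0 i / l) = m i].

Definition cell_idx l x : {ffun 'I_n -> int} := [ffun i => Num.floor (x ord0 i / l)].

Definition cube l x := cell l (cell_idx l x).

Lemma cubeP l x y : cube l x y <-> cell_idx l y = cell_idx l x.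
Proof.
split=> [h|h i]; last by move/ffunP: h => /(_ i); rewrite !ffunE.
by apply/ffunP => i; have := h i; rewrite !ffunE.
Qed.

Lemma cube_refl l x : cube l x x.
Proof. exact/cubeP. Qed.

Lemma eq_cube l x y : cube l x y -> cube l y = cube l x.
Proof. by move=> /cubeP h; rewrite /cube h. Qed.

Lemma measurable_box (B : 'I_n -> set (measurableTypeR R)) :
  (forall i, measurable (B i)) ->
  measurable [set y : 'rV[R]_n | forall i, B i (y ord0 i)].
Proof.
move=> mB; rewrite [X in measurable X](_ : _ =
    \bigcap_(i in [set: 'I_n]) (@rV_coord R n i @^-1` B i)).
  apply: fin_bigcap_measurable => // i _; rewrite -[X in measurable X]setTI.
  exact: measurable_rV_coord.
by apply/seteqP; split => [x h i _|x h i]; apply: h.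
Qed.

Definition cell_itv l (m : {ffun 'I_n -> int}) i : set (measurableTypeR R) :=
  `[(m i)%:~R * l, (m i + 1)%:~R * l[%classic.

Lemma cellE l m : 0 < l ->
  cell l m = [set y : 'rV[R]_n | forall i, cell_itv l m i (y ord0 i)].
Proof.
move=> l0; apply/seteqP; split => y /= h i; have /= := h i;
  rewrite /cell_itv /= in_itv/=.
- by move=> /eqP; rewrite floor_eq ler_pdivlMr// ltr_pdivrMr.
- by move=> h'; apply/eqP; rewrite floor_eq ler_pdivlMr// ltr_pdivrMr.
Qed.

Lemma measurable_cell l m : 0 < l -> measurable (cell l m).
Proof.
by move=> l0; rewrite cellE//; apply: measurable_box => i; exact: measurable_itv.
Qed.

Lemma measurable_cube l x : 0 < l -> measurable (cube l x).
Proof. exact: measurable_cell. Qed.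

Lemma lebesgue_cube l x : 0 < l -> lebesgue_rV R n (cube l x) = (l ^+ n)%:E.
Proof.
move=> l0; rewrite /cube cellE// lebesgue_rV_box; last first.
  by move=> i; exact: measurable_itv.
under eq_bigr do rewrite lebesgue_measure_itv/= lte_fin ltr_pM2r// ltr_int ltrDl ltr01
   -EFinB -mulrBl -intrB addrAC subrr add0r mul1r.
by rewrite prodEFin prodr_const card_ord.
Qed.

(** The cell of side [2 l] only depends on the cell of side [l], since the floor of
[u / 2] only depends on the floor of [u]. *)
Lemma cell_idx_double l x y : 0 < l ->
  cell_idx l y = cell_idx l x -> cell_idx (2 * l) y = cell_idx (2 * l) x.
Proof.
move=> l0 /ffunP h; apply/ffunP => i; have := h i; rewrite !ffunE => hi.
set q := Num.floor (x ord0 i / (2 * l)).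
apply/eqP; rewrite floor_eq ler_pdivlMr ?mulr_gt0// ltr_pdivrMr ?mulr_gt0//.
have : q == q by [].
rewrite {1}/q floor_eq ler_pdivlMr ?mulr_gt0// ltr_pdivrMr ?mulr_gt0//.
rewrite !mulrA -!ler_pdivlMr// -!ltr_pdivrMr//.
have E (k : int) : k%:~R * 2 = (k * 2)%:~R :> R by rewrite intrM.
have two : 0 < 2 :> R by [].
rewrite !(ler_pdivlMr _ _ two) !(ltr_pdivrMr _ _ two) !E.
by rewrite -!floor_ge_int -!floor_lt_int hi.
Qed.

Lemma cube_double l x : 0 < l -> cube l x `<=` cube (2 * l) x.
Proof. by move=> l0 y /cubeP h; apply/cubeP; exact: cell_idx_double. Qed.

Lemma cube_coord l x y i : 0 < l -> cube l x y -> `|y ord0 i - x ord0 i| < l.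
Proof.
move=> l0 /cubeP /ffunP /(_ i); rewrite !ffunE => h.
have /andP[a1 a2] := floor_itv (x ord0 i / l).
have /andP[b1 b2] := floor_itv (y ord0 i / l).
move: a1 a2 b1 b2; rewrite h; set q := Num.floor _; rewrite intrD.
rewrite !ler_pdivlMr// !ltr_pdivrMr// => a1 a2 b1 b2.
rewrite ltr_norml; apply/andP; split; lra.
Qed.

Lemma dyadic_lt (l e : R) : 0 < e -> exists k, l / 2 ^+ k < e.
Proof.
move=> e0; exists (Num.bound `|l / e|).
rewrite ltr_pdivrMr ?exprn_gt0// -ltr_pdivrMl// mulrC.
apply: le_lt_trans (ler_norm _) _.
apply: lt_trans (archi_boundP (normr_ge0 _)) _.
by rewrite -natrX ltr_nat ltn_expl.
Qed.

Lemma open_cube (U : set 'rV[R]_n) x l : 0 < l -> open U -> U x ->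
  exists k, cube (l / 2 ^+ k) x `<=` U.
Proof.
move=> l0 oU Ux; have /nbhs_ballP[e /= e0 eU] := open_nbhs_nbhs (conj oU Ux).
have [k ke] := dyadic_lt l e e0; exists k => y yx; apply: eU.
split=> // i j; rewrite [i]ord1 /ball /= distrC.
by apply: lt_trans ke; apply: cube_coord yx; rewrite divr_gt0// exprn_gt0.
Qed.

(** An open set is the union of the cells of side [2^-k] that it contains, and
there are countably many cells. *)
Lemma open_measurable_rV (U : set 'rV[R]_n) : open U -> measurable U.
Proof.
move=> oU.
pose G (p : nat) : set 'rV[R]_n :=
  if unpickle p is Some (k, m) then
    (if `[< cell (1 / 2 ^+ k) m `<=` U >] then cell (1 / 2 ^+ k) m else set0)
  else set0.
have -> : U = \bigcup_p G p.
  apply/seteqP; split => [x Ux|x [p _]].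
    have [k kU] := open_cube U x 1 ltr01 oU Ux.
    exists (pickle (k, cell_idx (1 / 2 ^+ k) x)) => //; rewrite /G pickleK.
    by case: asboolP => // _; exact: cube_refl.
  rewrite /G; case: (unpickle p) => [[k m]|//].
  by case: asboolP => // kU /kU.
apply: bigcup_measurable => p _; rewrite /G; case: (unpickle p) => [[k m]|//].
by case: asboolP => // kU; apply: measurable_cell; rewrite divr_gt0// exprn_gt0.
Qed.

Lemma continuous_measurable_rV (f : 'rV[R]_n -> R) :
  continuous f -> measurable_fun setT (f : 'rV[R]_n -> measurableTypeR R).
Proof.
move=> /continuousP cf; apply: (measurability _ (RGenOpens.measurableE R)).
move=> _ [_ [a [b ->] <-]]; rewrite setTI; apply: open_measurable_rV.
exact/cf/interval_open.
Qed.

(** A compact set lies in a box, whose volume bounds the measure of all its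
measurable subsets. *)
Lemma compact_lebesgue_lty (K : set 'rV[R]_n) : compact K ->
  exists M : R, forall A, measurable A -> A `<=` K -> (lebesgue_rV R n A <= M%:E)%E.
Proof.
move=> /compact_bounded [M0 [_ /(_ (`|M0| + 1))]].
have -> : M0 < `|M0| + 1 by rewrite (le_lt_trans (ler_norm _))// ltrDl.
move=> /(_ isT) h; set b := `|M0| + 1 in h.
pose B (i : 'I_n) : set (measurableTypeR R) := `[- b, b]%classic.
exists ((b + b) ^+ n) => A mA AK.
have -> : ((b + b) ^+ n)%:E = lebesgue_rV R n [set x | forall i, B i (x ord0 i)].
  rewrite (@lebesgue_rV_box R n B); last by move=> i; exact: measurable_itv.
  have b0 : 0 < b by rewrite ltr_pwDr.
  under eq_bigr do rewrite lebesgue_measure_itv/= lte_fin gtrN// -EFinB opprK.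
  by rewrite prodEFin prodr_const card_ord.
apply: le_measure; rewrite ?inE//.
  by apply: measurable_box => i; exact: measurable_itv.
move=> x /AK /h /= hx i; rewrite /B /= in_itv/= -ler_norml.
apply: le_trans hx; rewrite [`|x|]mx_normrE.
by rewrite (bigmax_sup (ord0, i)).
Qed.

End cubes.

(** * Sums over dyadic scales *)

Section dyadic_sums.
Context {R : realType}.
Implicit Types (p r L : R).

Lemma powRN_le p r L : 0 <= p -> 0 < r -> r <= L -> L `^ (- p) <= r `^ (- p).
Proof.
move=> p0 r0 rL; have L0 := lt_le_trans r0 rL.
rewrite !powRN lef_pV2 ?posrE ?powR_gt0//.
by apply: ge0_ler_powR => //; rewrite nnegrE ltW.
Qed.

Lemma powRN_half_ge p L : 1 <= p -> 0 < L -> 2 * L `^ (- p) <= (L / 2) `^ (- p).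
Proof.
move=> p1 L0; rewrite powRM; [|exact: ltW|by rewrite invr_ge0].
rewrite mulrC ler_pM2l ?powR_gt0//.
rewrite -powR_inv1// -powRrM mulN1r opprK.
by rewrite -[leLHS]powRr1// ler_powR// ler1n.
Qed.

(** A geometric sum is controlled by its largest term, which is the one for the
smallest scale [L / 2^k] above [r]; the induction needs at the same time the
bound by the next term of the sum, which does not depend on [r]. *)
Lemma layer_cake p r L N : 1 <= p -> 0 < r -> 0 < L ->
  \sum_(k < N) (L / 2 ^+ k) `^ (- p) * (r < L / 2 ^+ k)%R%:R <= 2 * r `^ (- p).
Proof.
move=> p1 r0 L0.
have LN0 k : 0 < L / 2 ^+ k by rewrite divr_gt0// exprn_gt0.
have LS k : L / 2 ^+ k.+1 = L / 2 ^+ k / 2.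
  by rewrite exprSr invfM mulrA.
suff : \sum_(k < N) (L / 2 ^+ k) `^ (- p) * (r < L / 2 ^+ k)%R%:R <=
    (L / 2 ^+ N) `^ (- p) /\
  \sum_(k < N) (L / 2 ^+ k) `^ (- p) * (r < L / 2 ^+ k)%R%:R <= 2 * r `^ (- p) by case.
elim: N => [|N [IH1 IH2]].
  by rewrite !big_ord0; split; rewrite ?mulr_ge0// powR_ge0.
rewrite !big_ord_recr /=.
have step : \sum_(k < N) (L / 2 ^+ k) `^ (- p) * (r < L / 2 ^+ k)%R%:R +
    (L / 2 ^+ N) `^ (- p) * (r < L / 2 ^+ N)%R%:R <= 2 * (L / 2 ^+ N) `^ (- p).
  rewrite mulr_natl mulr2n lerD//; case: (r < _); rewrite ?mulr1// mulr0.
  exact: powR_ge0.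
split.
  by apply: (le_trans step); rewrite LS; exact: powRN_half_ge.
have [rN|rN] := ltP r (L / 2 ^+ N); last by rewrite mulr0 addr0.
rewrite rN in step; apply: (le_trans step).
rewrite ler_pM2l//; apply: powRN_le => //; last exact: ltW.
exact: le_trans p1.
Qed.

(** About [1 / b] terms of the sum are at least one half, which is as much as the
full geometric series up to a constant and avoids any limit. *)
Lemma dyadic_sum_ge (b : R) : 0 < b -> exists N : nat, (0 < N)%N /\
  (2 * b)^-1 <= \sum_(k < N) 2 `^ (- (b * k%:R)).
Proof.
move=> b0; have bi : 0 <= b^-1 by rewrite invr_ge0 ltW.
exists (Num.truncn b^-1).+1; split => //.
have /andP[h1 h2] := truncn_itv bi.
apply: (@le_trans _ _ (\sum_(k < (Num.truncn b^-1).+1) 2^-1)).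
  by rewrite sumr_const card_ord -[leRHS]mulr_natr invfM ler_pM2l ?invr_gt0// ltW.
apply: ler_sum => k _.
rewrite -[leLHS]powR_inv1// ler_powR ?ler1n// lerN2 mulrC -ler_pdivlMr// div1r.
by apply: le_trans h1; rewrite ler_nat -ltnS.
Qed.

End dyadic_sums.

(** * The interaction of two sets *)

Section kernel.
Local Open Scope classical_set_scope.
Context {R : realType} {n : nat}.
Local Notation V := 'rV[R]_n.
Implicit Types (x y z : V) (w : V * V).

Lemma enormZ c x : enorm (c *: x) = `|c| * enorm x.
Proof.
rewrite /enorm -sqrtr_sqr -sqrtrM ?sqr_ge0//; congr Num.sqrt.
by rewrite mulr_sumr; apply: eq_bigr => i _; rewrite mxE exprMn.
Qed.

Lemma enorm_gt0 x : x != 0 -> 0 < enorm x.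
Proof.
move=> x0; rewrite sqrtr_gt0 lt_neqAle sumr_ge0 ?andbT; last by move=> *; exact: sqr_ge0.
apply: contra_neq x0 => /esym/eqP; rewrite psumr_eq0; last by move=> *; exact: sqr_ge0.
move=> /allP h; apply/rowP => i; rewrite mxE; apply/eqP.
by rewrite -sqrf_eq0; apply: h; rewrite mem_index_enum.
Qed.

Lemma measurable_enormB :
  measurable_fun setT ((fun w => enorm (w.2 - w.1)) : V * V -> measurableTypeR R).
Proof.
rewrite (_ : (fun _ => _) = (fun t : R => t `^ 2^-1) \o
   (fun w : V * V => \sum_(i < n) (rV_coord i w.2 - rV_coord i w.1) ^+ 2)); last first.
  apply/funext => w /=; rewrite powR12_sqrt; last first.
    by rewrite sumr_ge0// => *; exact: sqr_ge0.
  by congr Num.sqrt; apply: eq_bigr => i _; rewrite !mxE.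
apply: measurableT_comp; first exact: measurable_powR.
apply: measurable_sum => i; apply: measurable_funX; apply: measurable_funB.
  by apply: measurableT_comp; [exact: measurable_rV_coord|exact: measurable_snd].
by apply: measurableT_comp; [exact: measurable_rV_coord|exact: measurable_fst].
Qed.

Definition kernel (p : R) w : R := (enorm (w.2 - w.1) `^ p)^-1.

Lemma kernel_ge0 p w : 0 <= kernel p w.
Proof. by rewrite invr_ge0 powR_ge0. Qed.

Lemma measurable_kernel p : measurable_fun setT (kernel p : V * V -> measurableTypeR R).
Proof.
rewrite (_ : kernel p = (fun t : R => t `^ (- p)) \o (fun w => enorm (w.2 - w.1))).
  by apply: measurableT_comp; [exact: measurable_powR|exact: measurable_enormB].
by apply/funext => w /=; rewrite powRN.
Qed.

Definition lebesgue_rV_prod := (lebesgue_rV R n \x lebesgue_rV R n)%E.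

Local Notation mu2 := lebesgue_rV_prod.

Definition interaction (p : R) (D : set (V * V)) : \bar R :=
  (\int[mu2]_(w in D) (kernel p w)%:E)%E.

(** The kernel is bounded below by a combination of the indicators of the [S k], by
[layer_cake] applied to the distance of the pair. *)
Lemma interaction_ge (p L : R) (A B : set V) (S : nat -> set (V * V)) (N : nat) :
  1 <= p -> 0 < L -> measurable A -> measurable B -> A `&` B = set0 ->
  (forall k, measurable (S k)) -> (forall k, S k `<=` A `*` B) ->
  (forall k w, (k < N)%N -> S k w -> enorm (w.2 - w.1) < L / 2 ^+ k) ->
  (\sum_(k < N) (2^-1 * (L / 2 ^+ k) `^ (- p))%:E * mu2 (S k) <=
   interaction p (A `*` B))%E.
Proof.
move=> p1 L0 mA mB AB0 mS SAB Slt.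
have c0 k : 0 <= 2^-1 * (L / 2 ^+ k) `^ (- p).
  by rewrite mulr_ge0 ?invr_ge0// powR_ge0.
have mAB : measurable (A `*` B) by exact: measurableX.
have -> : (\sum_(k < N) (2^-1 * (L / 2 ^+ k) `^ (- p))%:E * mu2 (S k) =
  \int[mu2]_(w in A `*` B) \sum_(k < N) (2^-1 * (L / 2 ^+ k) `^ (- p) * \1_(S k) w)%:E)%E.
  rewrite ge0_integral_sum//; last 2 first.
  - move=> k; apply/measurable_EFinP; apply: measurable_funM; first exact: measurable_cst.
    by apply: measurable_indic.
  - by move=> k w _; rewrite lee_fin mulr_ge0.
  apply: eq_bigr => k _; under eq_integral do rewrite EFinM.
  rewrite ge0_integralZl ?lee_fin//; last first.
    by apply/measurable_EFinP; exact: measurable_indic.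
  by rewrite integral_indic// setIidl.
apply: ge0_le_integral_pointwise => /= -[z y] [/= Az By].
  by apply: sume_ge0 => k _; rewrite lee_fin mulr_ge0.
rewrite sumEFin lee_fin.
have yz : 0 < enorm (y - z).
  apply: enorm_gt0; rewrite subr_eq0; apply/eqP => yz.
  by change (set0 z); rewrite -AB0; split => //; rewrite -yz.
have := layer_cake p _ L N p1 yz L0; rewrite -ler_pdivrMl// /kernel /= -powRN.
apply: le_trans; rewrite mulr_sumr; apply: ler_sum => k _.
rewrite mulrA ler_wpM2l// indicE ler_nat.
case: (boolP (_ \in S k)) => //; rewrite inE => /(Slt k _ (ltn_ord k)) /= -> //.
Qed.

End kernel.

(** * Halving the distance of pairs across a set *)

Section pairs.
Local Open Scope classical_set_scope.
Context {R : realType} {n : nat}.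
Local Notation V := 'rV[R]_n.
Local Notation mu := (lebesgue_rV R n).
Local Notation mu2 := (@lebesgue_rV_prod R n).
Implicit Types (x y z : V) (w : V * V).

Lemma measurable_comb d (T : measurableType d) (f g : T -> V) (a b : R) :
  measurable_fun setT f -> measurable_fun setT g ->
  measurable_fun setT (fun t => a *: f t + b *: g t).
Proof.
move=> mf mg; apply: measurable_fun_rV => i.
rewrite (_ : _ \o _ = (fun t => a * rV_coord i (f t) + b * rV_coord i (g t))).
  apply: measurable_funD; apply: measurable_funM; try exact: measurable_cst.
    by apply: measurableT_comp mf; exact: measurable_rV_coord.
  by apply: measurableT_comp mg; exact: measurable_rV_coord.
by apply/funext => t /=; rewrite /rV_coord !mxE.
Qed.

Definition shear_snd (a b : R) w : V * V := (w.1, a *: w.2 + b *: w.1).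

Definition shear_fst (a b : R) w : V * V := (a *: w.1 + b *: w.2, w.2).

Lemma measurable_shear_snd (a b : R) : measurable_fun setT (shear_snd a b).
Proof.
apply/measurable_fun_pairP; split => /=; first exact: measurable_fst.
by apply: measurable_comb; [exact: measurable_snd|exact: measurable_fst].
Qed.

Lemma measurable_shear_fst (a b : R) : measurable_fun setT (shear_fst a b).
Proof.
apply/measurable_fun_pairP; split => /=; last exact: measurable_snd.
by apply: measurable_comb; [exact: measurable_fst|exact: measurable_snd].
Qed.

Lemma lebesgue_rV_prod_shear_snd (a : {posnum R}) (b : R) (D : set (V * V)) :
  measurable D ->
  mu2 D = ((a%:num ^+ n)%:E * mu2 (shear_snd a%:num b @^-1` D))%E.
Proof.
move=> mD.
have mD' : measurable (shear_snd a%:num b @^-1` D).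
  by rewrite -[X in measurable X]setTI; exact: measurable_shear_snd.
rewrite /lebesgue_rV_prod /product_measure1 -ge0_integralZl//; last first.
  exact: (measurable_fun_xsection mu).
apply: eq_integral => z _ /=; rewrite (lebesgue_rV_affine n (b *: z) a).
  by congr (_ * mu _)%E; apply/seteqP; split => y; rewrite /xsection /= !inE.
exact: measurable_xsection.
Qed.

(** Slicing along the second variable gives the same measure. *)
Lemma lebesgue_rV_prod_swap (D : set (V * V)) : measurable D ->
  mu2 D = (mu \x^ mu)%E D.
Proof.
move=> mD; apply: product_measure_unique => // A B mA mB.
exact: product_measure2E.
Qed.

Lemma lebesgue_rV_prod_shear_fst (a : {posnum R}) (b : R) (D : set (V * V)) :
  measurable D ->
  mu2 D = ((a%:num ^+ n)%:E * mu2 (shear_fst a%:num b @^-1` D))%E.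
Proof.
move=> mD.
have mD' : measurable (shear_fst a%:num b @^-1` D).
  by rewrite -[X in measurable X]setTI; exact: measurable_shear_fst.
rewrite !lebesgue_rV_prod_swap// /product_measure2 -ge0_integralZl//; last first.
  exact: (measurable_fun_ysection mu).
apply: eq_integral => z _ /=; rewrite (lebesgue_rV_affine n (b *: z) a).
  by congr (_ * mu _)%E; apply/seteqP; split => y; rewrite /ysection /= !inE.
exact: measurable_ysection.
Qed.

Definition close_pairs (A B : set V) (rho : R) : set (V * V) :=
  (A `*` B) `&` [set w | enorm (w.2 - w.1) < rho].

Lemma measurable_close_pairs A B rho : measurable A -> measurable B ->
  measurable (close_pairs A B rho).
Proof.
move=> mA mB; apply: measurableI; first exact: measurableX.
rewrite (_ : [set w | _] =
    (fun w : V * V => enorm (w.2 - w.1)) @^-1` `]-oo, rho[); last first.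
  by apply/seteqP; split => w /=; rewrite in_itv.
rewrite -[X in measurable X]setTI.
by apply: measurable_enormB => //; exact: measurable_itv.
Qed.

(** The pair [(z, y)] is mapped to (midpoint, [y]) or to ([z], midpoint) according
to whether the midpoint lies in [E]; each of these shears multiplies volumes by
[2^-n]. *)
Lemma close_pairs_halving (Q E : set V) (rho : R) : measurable Q -> measurable E ->
  (forall x y, Q x -> Q y -> Q (2^-1 *: x + 2^-1 *: y)) ->
  (mu2 (close_pairs (E `&` Q) (Q `\` E) rho) <=
   (2 ^+ n.+1)%:E * mu2 (close_pairs (E `&` Q) (Q `\` E) (rho / 2)))%E.
Proof.
move=> mQ mE cQ; set A := E `&` Q; set B := Q `\` E.
have mA : measurable A by exact: measurableI.
have mB : measurable B by exact: measurableD.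
have mP r : measurable (close_pairs A B r) by exact: measurable_close_pairs.
set P := close_pairs A B (rho / 2).
have mP0 : measurable P by exact: mP.
have h0 : 0 < 2^-1 :> R by rewrite invr_gt0.
pose h := PosNum h0.
pose T1 := shear_fst h%:num 2^-1 @^-1` P.
pose T2 := shear_snd h%:num 2^-1 @^-1` P.
have mT1 : measurable T1.
  by rewrite -[X in measurable X]setTI; apply: measurable_shear_fst => //; exact: mP.
have mT2 : measurable T2.
  by rewrite -[X in measurable X]setTI; apply: measurable_shear_snd => //; exact: mP.
have sub : close_pairs A B rho `<=` T1 `|` T2.
  move=> -[z y] [[/= [Ez Qz] [Qy nEy]] /= zy].
  have eq1 : enorm (y - (2^-1 *: z + 2^-1 *: y)) = enorm (y - z) / 2.
    rewrite mulrC -[in RHS](@ger0_norm _ 2^-1) ?invr_ge0// -enormZ.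
    by congr enorm; apply/rowP => i; rewrite !mxE; field.
  have eq2 : enorm (2^-1 *: y + 2^-1 *: z - z) = enorm (y - z) / 2.
    rewrite mulrC -[in RHS](@ger0_norm _ 2^-1) ?invr_ge0// -enormZ.
    by congr enorm; apply/rowP => i; rewrite !mxE; field.
  have lt2 : enorm (y - z) / 2 < rho / 2 by rewrite ltr_pM2r.
  have [Em|nEm] := pselect (E (2^-1 *: z + 2^-1 *: y)).
    left; split => /=; last by rewrite eq1.
    by split => //; split => //; exact: cQ.
  right; split => /=; last by rewrite eq2.
  by split => //; split; [exact: cQ|rewrite addrC].
apply: (@le_trans _ _ (mu2 T1 + mu2 T2)%E).
  apply: le_trans (measureU2 _ mT1 mT2).
  by apply: le_measure => //; rewrite inE//; exact: measurableU.
have hn : (2 ^+ n * h%:num ^+ n = 1 :> R) by rewrite -exprMn divff// expr1n.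
have -> : mu2 T1 = ((2 ^+ n)%:E * mu2 P)%E.
  by rewrite (lebesgue_rV_prod_shear_fst h 2^-1 P)// muleA -EFinM hn mul1e.
have -> : mu2 T2 = ((2 ^+ n)%:E * mu2 P)%E.
  by rewrite (lebesgue_rV_prod_shear_snd h 2^-1 P)// muleA -EFinM hn mul1e.
rewrite -ge0_muleDl ?lee_fin ?exprn_ge0// -EFinD exprS.
by rewrite mulr_natl mulr2n.
Qed.

End pairs.

(** * The interaction of a cube of intermediate density *)

Section cube_interaction.
Local Open Scope classical_set_scope.
Context {R : realType} {n : nat}.
Local Notation V := 'rV[R]_n.
Local Notation mu := (lebesgue_rV R n).
Local Notation mu2 := (@lebesgue_rV_prod R n).
Implicit Types (x y z : V) (l : R).

Lemma cube_midpoint l x y z : 0 < l -> cube l x y -> cube l x z ->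
  cube l x (2^-1 *: y + 2^-1 *: z).
Proof.
move=> l0; rewrite /cube cellE// => /= hy hz i; have := hy i; have := hz i.
rewrite /cell_itv /= !in_itv/= !mxE => /andP[z1 z2] /andP[y1 y2]; apply/andP; split; lra.
Qed.

Lemma cube_enorm l x y z : 0 < l -> cube l x y -> cube l x z ->
  enorm (y - z) < n.+1%:R * l.
Proof.
move=> l0 yx zx; have nl0 : 0 < n.+1%:R * l by rewrite mulr_gt0.
rewrite -[ltRHS]ger0_norm ?ltW// -sqrtr_sqr /enorm ltr_sqrt ?exprn_gt0//.
have zy : cube l z y by rewrite (eq_cube _ _ _ zx).
apply: (@le_lt_trans _ _ (\sum_(i < n) l ^+ 2)).
  apply: ler_sum => i _; rewrite !mxE -real_normK ?num_real//.
  by rewrite lerXn2r ?nnegrE ?normr_ge0 ?ltW//; have := cube_coord l z y i l0 zy.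
rewrite sumr_const card_ord -[ltLHS]mulr_natl exprMn ltr_pM2r ?exprn_gt0//.
by rewrite -natrX ltr_nat (@leq_trans n.+1)// -mulnn leq_pmulr.
Qed.

Lemma powRE_exp (a b : R) : 0 < a -> a `^ b = expR (b * ln a).
Proof. by move=> a0; rewrite /powR gt_eqF. Qed.

Lemma exprn_exp (a : R) (k : nat) : 0 < a -> a ^+ k = expR (k%:R * ln a).
Proof. by move=> a0; rewrite -powR_mulrn ?ltW// powRE_exp. Qed.

(** The factor [(2 ^+ n.+1)^-1] is the density threshold of the selected cubes, and
[n.+1%:R] bounds the ratio of the diameter of a cube to its side, so that
[n.+1%:R ^+ n.+1] bounds its powers of exponent [alpha + n] for all [alpha < 1]
at once. *)
Definition cube_const : R := 4^-1 * (2 ^+ n.+1)^-1 * (n.+1%:R ^+ n.+1)^-1.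

Lemma cube_const_gt0 : 0 < cube_const.
Proof. by rewrite !mulr_gt0// invr_gt0// exprn_gt0. Qed.

Lemma cube_const_le (alpha u : R) : alpha < 1 -> 0 < u ->
  cube_const * u <=
  4^-1 * (2 ^+ n.+1)^-1 * (n.+1%:R `^ (- (alpha + n%:R)) * u).
Proof.
move=> a1 u0; rewrite /cube_const -!mulrA.
do 2 (rewrite ler_pM2l; last by rewrite invr_gt0// exprn_gt0).
rewrite ler_pM2r// -powR_mulrn// -powRN ler_powR ?ler1n// lerN2.
by rewrite -[in leRHS]addn1 natrD; lra.
Qed.

(** The contribution of the [k]-th scale in [near_interaction]: all powers combine
into [l^(n - alpha) 2^(-k (1 - alpha))]. *)
Lemma near_powers (alpha l : R) (k : nat) : 0 < alpha < 1 -> 0 < l ->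
  cube_const * l `^ (n%:R - alpha) * 2 `^ (- ((1 - alpha) * k%:R)) <=
  2^-1 * (n.+1%:R * l / 2 ^+ k) `^ (- (alpha + n%:R)) *
   ((2 ^+ n.+1) ^- k * ((2 ^+ n.+1)^-1 * l ^+ n * (2^-1 * l ^+ n))).
Proof.
move=> /andP[a0 a1] l0.
have D0 : 0 < n.+1%:R :> R by [].
have t0 : 0 < 2 :> R by [].
have key : (n.+1%:R * l / 2 ^+ k) `^ (- (alpha + n%:R)) *
    ((2 ^+ n.+1) ^- k * (l ^+ n * l ^+ n)) =
  n.+1%:R `^ (- (alpha + n%:R)) * (l `^ (n%:R - alpha) * 2 `^ (- ((1 - alpha) * k%:R))).
  rewrite -exprM !powRE_exp//; last by rewrite divr_gt0 ?exprn_gt0// mulr_gt0.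
  rewrite !ln_div ?lnM ?lnXn ?posrE ?mulr_gt0 ?exprn_gt0//.
  rewrite !exprn_exp// -expRN -!expRD; congr expR.
  by rewrite -[ln 2 *+ k]mulr_natr natrM -[n.+1]addn1 natrD; ring.
rewrite -[leLHS]mulrA; apply: (le_trans (cube_const_le alpha _ a1 _)).
  by rewrite mulr_gt0 ?powR_gt0.
rewrite le_eqVlt; apply/orP; left; apply/eqP.
rewrite -key; set u := _ `^ (- _); set v := _ ^- k.
set w := (_ ^+ n.+1)^-1; set m := l ^+ n.
by field.
Qed.

(** The contribution of the [k]-th ancestor in [far_interaction]: all powers combine
into [l^(n - alpha) 2^(-k alpha)]. *)
Lemma far_powers (alpha l : R) (k : nat) : 0 < alpha < 1 -> 0 < l ->
  cube_const * l `^ (n%:R - alpha) * 2 `^ (- (alpha * k%:R)) <=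
  2^-1 * (n.+1%:R * (2 ^+ k * l)) `^ (- (alpha + n%:R)) *
   ((2 ^+ n.+1)^-1 * l ^+ n * (2^-1 * (2 ^+ k * l) ^+ n)).
Proof.
move=> /andP[a0 a1] l0.
have D0 : 0 < n.+1%:R :> R by [].
have t0 : 0 < 2 :> R by [].
have key : (n.+1%:R * (2 ^+ k * l)) `^ (- (alpha + n%:R)) *
    (l ^+ n * (2 ^+ k * l) ^+ n) =
  n.+1%:R `^ (- (alpha + n%:R)) * (l `^ (n%:R - alpha) * 2 `^ (- (alpha * k%:R))).
  rewrite exprMn -exprM !powRE_exp//; last by rewrite !mulr_gt0 ?exprn_gt0.
  rewrite !lnM ?lnXn ?posrE ?mulr_gt0 ?exprn_gt0//.
  rewrite !exprn_exp// -!expRD; congr expR.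
  by rewrite -[ln 2 *+ k]mulr_natr natrM; ring.
rewrite -[leLHS]mulrA; apply: (le_trans (cube_const_le alpha _ a1 _)).
  by rewrite mulr_gt0 ?powR_gt0.
rewrite le_eqVlt; apply/orP; left; apply/eqP.
rewrite -key; set u := _ `^ (- _); set w := (_ ^+ n.+1)^-1; set m := l ^+ n.
by field.
Qed.

End cube_interaction.

Section cube_interaction_bound.
Local Open Scope classical_set_scope.
Context {R : realType} {n : nat}.
Local Notation V := 'rV[R]_n.
Local Notation mu := (lebesgue_rV R n).
Local Notation mu2 := (@lebesgue_rV_prod R n).
Variables (alpha l : R) (x : V) (E : set V).
Hypotheses (n0 : (0 < n)%N) (alpha01 : 0 < alpha < 1) (l0 : 0 < l) (mE : measurable E).
Let Q := cube l x.
Let A := E `&` Q.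
Hypothesis dens : (((2 ^+ n.+1)^-1 * l ^+ n)%:E <= mu A)%E.

Let l_ge0 : 0 <= l. Proof. exact: ltW. Qed.

Let p1 : 1 <= alpha + n%:R.
Proof.
move: alpha01 => /andP[a0 _]; have := n0; rewrite -(ler_nat R) => n1.
by rewrite -[leLHS]add0r lerD// ltW.
Qed.

Let mQ : measurable Q. Proof. exact: measurable_cube. Qed.

Let mA : measurable A. Proof. exact: measurableI. Qed.

Lemma lebesgue_rV_prod_setX (B C : set V) : measurable B -> measurable C ->
  mu2 (B `*` C) = (mu B * mu C)%E.
Proof. exact: product_measure1E. Qed.

Lemma interaction_mono (p : R) (D D' : set (V * V)) : measurable D -> measurable D' ->
  D `<=` D' -> (interaction p D <= interaction p D')%E.
Proof.
move=> mD mD' DD'; apply: ge0_subset_integral => //.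
  by apply/measurable_EFinP; apply: measurable_funTS; exact: measurable_kernel.
by move=> w _; rewrite lee_fin kernel_ge0.
Qed.

(** Short range: only pairs inside the cube are used.  At distance [n.+1%:R * l]
every pair of points of the cube is close, and halving the distance [k] times
costs the factor [2^((n+1) k)]. *)
Lemma near_interaction (N : nat) :
  ((2^-1 * l ^+ n)%:E <= mu (Q `\` E))%E ->
  ((cube_const (R:=R) (n:=n) * l `^ (n%:R - alpha) *
     \sum_(k < N) 2 `^ (- ((1 - alpha) * k%:R)))%:E
   <= interaction (alpha + n%:R) (A `*` ~` E))%E.
Proof.
move=> codens; pose B := Q `\` E.
have mB : measurable B by exact: measurableD.
pose L := n.+1%:R * l; have L0 : 0 < L by rewrite mulr_gt0.
pose S k := close_pairs A B (L / 2 ^+ k).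
have mS k : measurable (S k) by exact: measurable_close_pairs.
have S0 : S 0%N = A `*` B.
  apply/seteqP; split => [w []//|[z y] [[Ez Qz] [Qy nEy]]]; split => //=.
  by rewrite expr0 divr1; exact: (cube_enorm l x).
have halving k : (((2 ^+ n.+1) ^- k)%:E * mu2 (S 0%N) <= mu2 (S k))%E.
  elim: k => [|k IH]; first by rewrite expr0 invr1 mul1e.
  rewrite exprS invfM EFinM -muleA.
  have c0 : 0 < 2 ^+ n.+1 :> R by rewrite exprn_gt0.
  rewrite lee_pdivrMl//; apply: (le_trans IH).
  rewrite /S (_ : L / 2 ^+ k.+1 = L / 2 ^+ k / 2); last by rewrite exprSr invfM mulrA.
  apply: close_pairs_halving => //.
  by move=> y z; exact: cube_midpoint.
have AB : (((2 ^+ n.+1)^-1 * l ^+ n * (2^-1 * l ^+ n))%:E <= mu2 (S 0%N))%E.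
  rewrite S0 lebesgue_rV_prod_setX// EFinM; apply: lee_pmul => //; rewrite lee_fin.
    by rewrite mulr_ge0 ?invr_ge0 ?exprn_ge0// ltW.
  by rewrite mulr_ge0 ?invr_ge0 ?exprn_ge0// ltW.
apply: (@le_trans _ _ (interaction (alpha + n%:R) (A `*` B))); last first.
  apply: interaction_mono; [exact: measurableX| |by move=> w [? []]].
  by apply: measurableX => //; exact: measurableC.
apply: le_trans
  (interaction_ge (alpha + n%:R) L A B S N _ _ _ _ _ _ _ _) => //; last 3 first.
- by apply/seteqP; split => // w [[Ew _] [_ nEw]].
- by move=> k w [].
- by move=> k w _ [].
rewrite mulr_sumr -sumEFin; apply: lee_sum => k _.
apply: le_trans (lee_pmul _ _ (lexx _) (halving k));
  rewrite ?lee_fin ?mulr_ge0 ?powR_ge0 ?invr_ge0//; last first.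
  by rewrite mule_ge0// lee_fin invr_ge0 !exprn_ge0.
apply: le_trans (lee_pmul _ _ (lexx _) (lee_pmul _ _ (lexx _) AB));
  rewrite ?lee_fin ?mulr_ge0 ?powR_ge0 ?invr_ge0 ?exprn_ge0//.
exact: near_powers.
Qed.

(** Long range: the pairs join the part of [E] in the cube to the complement of [E]
in its ancestors. *)
Lemma far_interaction (N : nat) : (0 < N)%N ->
  (forall k, (k < N)%N ->
    ((2^-1 * (2 ^+ k * l) ^+ n)%:E <= mu (cube (2 ^+ k * l) x `\` E))%E) ->
  ((cube_const (R:=R) (n:=n) * l `^ (n%:R - alpha) *
     \sum_(k < N) 2 `^ (- (alpha * k%:R)))%:E
   <= interaction (alpha + n%:R) (A `*` ~` E))%E.
Proof.
move=> N0 codens.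
have L0 k : 0 < 2 ^+ k * l by rewrite mulr_gt0// exprn_gt0.
(* The scales of [interaction_ge] decrease, whereas the sides of the ancestors
   increase: the [j]-th scale is matched with the ancestor of index
   [N - j.+1]. *)
pose L := n.+1%:R * (2 ^+ N.-1 * l).
have LE k : (k < N)%N -> L / 2 ^+ k = n.+1%:R * (2 ^+ (N - k.+1) * l).
  move=> kN; rewrite /L (_ : N.-1 = k + (N - k.+1))%N; last first.
    by rewrite -[in LHS](subnKC kN) addSn.
  by rewrite exprD; field; rewrite expf_neq0.
pose S j := A `*` (cube (2 ^+ (N - j.+1) * l) x `\` E).
have mS k : measurable (S k).
  apply: measurableX => //; apply: measurableD => //; exact: measurable_cube.
have nest k : cube l x `<=` cube (2 ^+ k * l) x.
  elim: k => [|k IH]; first by rewrite expr0 mul1r.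
  by apply: (subset_trans IH); rewrite exprS -mulrA; exact: cube_double.
apply: le_trans
  (interaction_ge (alpha + n%:R) L A (~` E) S N _ _ _ _ _ _ _ _) => //; last 5 first.
- by rewrite mulr_gt0.
- exact: measurableC.
- by apply/seteqP; split => // w [[Ew _] nEw].
- by move=> k w [? []].
- move=> k w kN [[_ Qz] [Qy _]]; rewrite LE//.
  by apply: (cube_enorm _ x) => //; exact: nest.
rewrite mulr_sumr -sumEFin (reindex_inj rev_ord_inj)/=; apply: lee_sum => k _.
rewrite lebesgue_rV_prod_setX//; last by apply: measurableD => //; exact: measurable_cube.
have jN : (N - k.+1 < N)%N by rewrite ltn_subrL.
rewrite LE//; move: (N - k.+1)%N jN => j jN.
apply: le_trans (lee_pmul _ _ (lexx _) (lee_pmul _ _ dens (codens j jN)));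
  rewrite ?lee_fin ?mulr_ge0 ?powR_ge0 ?invr_ge0 ?exprn_ge0//.
exact: far_powers.
all: exact: ltW.
Qed.

End cube_interaction_bound.

Section cube_interaction_total.
Local Open Scope classical_set_scope.
Context {R : realType} {n : nat}.
Local Notation mu := (lebesgue_rV R n).

(** The bounds by [1 / alpha] and by [1 / (1 - alpha)] together give
[1 / (alpha (1 - alpha))], because one of [alpha] and [1 - alpha] is at least
one half.  The number [N] of ancestors that must be controlled depends on
[alpha], the constant does not. *)
Lemma cube_interaction_ge (alpha : R) : (0 < n)%N -> 0 < alpha < 1 ->
  exists2 N : nat, (0 < N)%N & forall (l : R) (x : 'rV[R]_n) (E : set 'rV[R]_n),
  0 < l -> measurable E ->
  (((2 ^+ n.+1)^-1 * l ^+ n)%:E <= mu (E `&` cube l x))%E ->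
  (forall k, (k < N)%N ->
    ((2^-1 * (2 ^+ k * l) ^+ n)%:E <= mu (cube (2 ^+ k * l) x `\` E))%E) ->
  ((4^-1 * cube_const (R:=R) (n:=n) * l `^ (n%:R - alpha))%:E <=
   (alpha * (1 - alpha))%:E *
     interaction (alpha + n%:R) ((E `&` cube l x) `*` ~` E))%E.
Proof.
move=> n0 /[dup] alpha01 /andP[a0 a1].
have [N [N0 hN]] := dyadic_sum_ge alpha a0.
have b0 : 0 < 1 - alpha by rewrite subr_gt0.
have [M [M0 hM]] := dyadic_sum_ge (1 - alpha) b0.
exists N => // l x E l0 mE dens codens.
set s := l `^ _; have s0 : 0 < s by exact: powR_gt0.
have c0 := @cube_const_gt0 R n; set c := cube_const in c0 *.
set W := interaction _ _.
have far : (((c * s) / (2 * alpha))%:E <= W)%E.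
  apply: le_trans (far_interaction alpha l x E n0 alpha01 l0 mE dens N N0 codens).
  by rewrite lee_fin ler_pM2l// mulr_gt0.
have near : (((c * s) / (2 * (1 - alpha)))%:E <= W)%E.
  apply: le_trans (near_interaction alpha l x E n0 alpha01 l0 mE dens M _).
    by rewrite lee_fin ler_pM2l// mulr_gt0.
  by have := codens 0%N N0; rewrite expr0 mul1r.
(* [u] is the larger of [alpha] and [1 - alpha]. *)
have aux (t u : R) : 0 < t -> 0 < u -> 2^-1 <= u -> (((c * s) / (2 * t))%:E <= W)%E ->
    ((4^-1 * c * s)%:E <= (t * u)%:E * W)%E.
  move=> t0 u0 u2 h; apply: (@le_trans _ _ ((t * u)%:E * ((c * s) / (2 * t))%:E)%E).
    rewrite -EFinM lee_fin (_ : t * u * _ = u * (2^-1 * c * s)); last first.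
      by field; rewrite gt_eqF.
    rewrite (_ : 4^-1 * c * s = 2^-1 * (2^-1 * c * s)); last by field.
    by rewrite ler_pM2r// !mulr_gt0.
  apply: lee_pmul => //; rewrite lee_fin ltW// ?divr_gt0 ?mulr_gt0//.
have [h|h] := leP alpha 2^-1.
  by apply: aux => //; lra.
by rewrite [alpha * _]mulrC; apply: aux => //; lra.
Qed.

End cube_interaction_total.

(** * Maximal cubes *)

Section boxing.
Local Open Scope classical_set_scope.
Context {R : realType} {n : nat}.
Local Notation V := 'rV[R]_n.
Local Notation mu := (lebesgue_rV R n).
Implicit Types (x y : V).

Variables (E : set V) (L : R).
Hypotheses (L0 : 0 < L) (oE : open E).

Definition side (k : nat) : R := L / 2 ^+ k.

Lemma side_gt0 k : 0 < side k.
Proof. by rewrite divr_gt0// exprn_gt0. Qed.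

Lemma side_double k : side k = 2 * side k.+1.
Proof. by rewrite /side exprS; field; rewrite expf_neq0. Qed.

Lemma sideD k j : side k = 2 ^+ j * side (k + j).
Proof. by rewrite /side exprD; field; rewrite !expf_neq0. Qed.

Lemma side_cubeS j k x : (j <= k)%N -> cube (side k) x `<=` cube (side j) x.
Proof.
move=> /subnKC <-; elim: (k - j)%N => [|m IH]; first by rewrite addn0.
apply: subset_trans IH; rewrite addnS (side_double (j + m)).
exact/cube_double/side_gt0.
Qed.

(** The threshold is chosen so that a cube whose parent lies below it has density
at most one half. *)
Definition heavy (k : nat) x : bool :=
  `[< (((2 ^+ n.+1)^-1 * side k ^+ n)%:E <= mu (E `&` cube (side k) x))%E >].

(** The index of the largest heavy cube around [x]; the sides decrease with the
index. *)
Definition level x : nat :=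
  if pselect (exists k, heavy k x) is left e then ex_minn e else 0%N.

Let mE : measurable E. Proof. exact: open_measurable_rV. Qed.

Lemma heavy_cube k x y : cube (side k) x y -> heavy k y = heavy k x.
Proof. by move=> /eq_cube h; rewrite /heavy h. Qed.

Lemma ex_heavy x : E x -> exists k, heavy k x.
Proof.
move=> Ex; have [k kE] := open_cube E x L L0 oE Ex.
exists k; apply/asboolP; rewrite setIidr// lebesgue_cube ?side_gt0//.
rewrite lee_fin ler_piMl//; first exact/exprn_ge0/ltW/side_gt0.
rewrite invf_le1 ?exprn_gt0//.
by rewrite exprn_ege1// ler1n.
Qed.

Lemma heavy_level x : E x -> heavy (level x) x.
Proof.
move=> /ex_heavy ex; rewrite /level; case: pselect => // e.
by case: ex_minnP.
Qed.

Lemma level_min x j : E x -> (j < level x)%N -> ~~ heavy j x.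
Proof.
move=> /ex_heavy ex; rewrite /level; case: pselect => // e.
by case: ex_minnP => m _ h jm; apply/negP => /h; rewrite leqNgt jm.
Qed.

(** Two points of a cube of side [side k] share all the cubes of larger side, hence
the selected cube is the same for all points of [E] in it. *)
Lemma level_cube x y : E x -> E y -> cube (side (level x)) x y -> level y = level x.
Proof.
move=> Ex Ey yx; have same j : (j <= level x)%N -> heavy j y = heavy j x.
  by move=> jx; apply: heavy_cube; exact: (side_cubeS _ _ _ jx).
apply/eqP; rewrite eqn_leq; apply/andP; split.
  rewrite leqNgt; apply/negP => /(level_min _ _ Ey).
  by rewrite same// heavy_level.
rewrite leqNgt; apply/negP => lt; have := level_min _ _ Ex lt.
by rewrite -same ?(ltnW lt)// heavy_level.
Qed.

(** The next larger cube is not heavy, so that [E] fills at most one half of the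
cube itself. *)
Lemma level_ancestor_light x k : E x -> (k < level x)%N ->
  ((2^-1 * (2 ^+ k * side (level x)) ^+ n)%:E <=
    mu (cube (2 ^+ k * side (level x)) x `\` E))%E.
Proof.
move=> Ex kx; set l := 2 ^+ k * _.
have l0 : 0 < l by rewrite mulr_gt0 ?exprn_gt0// side_gt0.
(* [2 * l] is the side of the parent of [cube l x]. *)
have E2 : side (level x - k.+1) = 2 * l.
  by rewrite (sideD _ k.+1) subnK// exprS -mulrA.
have mQ : measurable (cube l x) by exact: measurable_cube.
have small : (mu (cube l x `&` E) <= (2^-1 * l ^+ n)%:E)%E.
  have := level_min x (level x - k.+1) Ex _; rewrite ltn_subrL (leq_ltn_trans _ kx)//.
  move=> /(_ isT) /asboolP/negP; rewrite -ltNge E2 => /ltW h.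
  apply: (@le_trans _ _ (mu (E `&` cube (2 * l) x))).
    apply: le_measure; rewrite ?inE; [exact: measurableI|apply: measurableI => //|].
      by apply: measurable_cube; rewrite mulr_gt0.
    by move=> y [yl Ey]; split => //; exact: cube_double.
  apply: (le_trans h); rewrite lee_fin exprS exprMn.
  by rewrite invfM -!mulrA mulKf// expf_neq0.
have : ((l ^+ n)%:E = mu (cube l x `\` E) + mu (cube l x `&` E))%E.
  by rewrite -(lebesgue_cube l x)//; exact: measureDI.
move: small; case: (mu (cube l x `\` E)) => [a| |];
  case: (mu (cube l x `&` E)) => [b| |] //=.
  by rewrite !lee_fin => bl [e]; lra.
Qed.

(** Numbering the points of [E] by their selected cube makes the selected cubes
fibres of a function, hence disjoint without further argument. *)
Definition piece_idx x : nat := pickle (level x, cell_idx (side (level x)) x).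

Definition piece (i : nat) : set V := E `&` [set x | piece_idx x = i].

Lemma pieceE i x : piece i x -> piece i = E `&` cube (side (level x)) x.
Proof.
move=> [Ex <-]; apply/seteqP; split => y [Ey h]; split => //.
  have [h1 h2] : (level y, cell_idx (side (level y)) y) =
    (level x, cell_idx (side (level x)) x) by exact: (pcan_inj pickleK).
  by apply/cubeP; rewrite -h1 h2 h1.
rewrite /= /piece_idx; have -> := level_cube _ _ Ex Ey h.
by congr (pickle (_, _)); apply/cubeP.
Qed.

Lemma measurable_piece i : measurable (piece i).
Proof.
have [->|/set0P[x ix]] := eqVneq (piece i) set0; first exact: measurable0.
rewrite (pieceE _ _ ix); apply: measurableI => //.
by apply: measurable_cube; exact: side_gt0.
Qed.

Lemma bigcup_piece : \bigcup_i piece i = E.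
Proof.
by apply/seteqP; split => [x [i _ []]//|x Ex]; exists (piece_idx x).
Qed.

Lemma trivIset_piece : trivIset setT piece.
Proof.
apply/trivIsetP => i j _ _ /eqP ij; apply/seteqP; split => // x [[_ xi] [_ xj]].
by apply: ij; rewrite -xi -xj.
Qed.

End boxing.

(** * The boxing inequality *)

Section boxing_inequality.
Local Open Scope classical_set_scope.
Context {R : realType} {n : nat}.
Local Notation V := 'rV[R]_n.
Local Notation mu := (lebesgue_rV R n).

Lemma powR_le_expr (a s : R) (k : nat) : 1 <= a -> s <= k%:R -> a `^ s <= a ^+ k.
Proof.
move=> a1 sk; rewrite -powR_mulrn; last exact: le_trans a1.
by rewrite ler_powR.
Qed.

(** The largest side [L] of the grid is chosen so that the cubes of levels up
to [N] are too large to be heavy: every selected cube then has the ancestors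
needed in [cube_interaction_ge]. *)
Lemma boxing (alpha W M : R) (E : set V) : (0 < n)%N -> 0 < alpha < 1 ->
  0 <= omega (n%:R - alpha) <= W -> open E -> (mu E <= M%:E)%E ->
  (hausdorff_content (n%:R - alpha) E <=
   (W * n.+1%:R ^+ n / (4^-1 * cube_const (R:=R) (n:=n)) * (alpha * (1 - alpha)))%:E *
    interaction (alpha + n%:R) (E `*` ~` E))%E.
Proof.
move=> n0 /[dup] alpha01 /andP[a0 a1] /andP[om0 omW] oE EM.
have mE : measurable E by exact: open_measurable_rV.
have [N N0 HN] := cube_interaction_ge alpha n0 alpha01.
set s := n%:R - alpha; set p := alpha + n%:R.
set c := 4^-1 * _; have c0 : 0 < c by rewrite mulr_gt0// cube_const_gt0.
have s0 : 0 < s by rewrite subr_gt0 (lt_le_trans a1)// ler1n.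
have W0 : 0 <= W by exact: le_trans omW.
(* A cube of side at least [m >= 1] has volume above [2 ^+ n.+1 * M], hence it is
   not heavy. *)
pose m := 1 + 2 ^+ n.+1 * `|M|.
have m1 : 1 <= m by rewrite lerDl mulr_ge0// exprn_ge0.
pose L := 2 ^+ N * m.
have L0 : 0 < L by rewrite mulr_gt0 ?exprn_gt0// (lt_le_trans _ m1).
have lvl x : E x -> (N < level E L x)%N.
  move=> Ex; rewrite ltnNge; apply/negP => le.
  have /asboolP := heavy_level E L L0 oE x Ex; apply/negP; rewrite -ltNge.
  apply: (@le_lt_trans _ _ M%:E).
    apply: le_trans EM; apply: le_measure; rewrite ?inE//.
    by apply: measurableI => //; apply: measurable_cube; exact: side_gt0.
  rewrite lte_fin.
  have mside : m <= side L (level E L x).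
    rewrite (sideD _ _ (N - level E L x)) subnKC// /side /L.
    rewrite [2 ^+ N * m]mulrC mulfK ?expf_neq0//.
    by rewrite ler_peMl ?(le_trans _ m1)// exprn_ege1// ler1n.
  apply: (@lt_le_trans _ _ ((2 ^+ n.+1)^-1 * m)).
    rewrite ltr_pdivlMl ?exprn_gt0// /m.
    apply: (@le_lt_trans _ _ (2 ^+ n.+1 * `|M|)); last by rewrite ltrDr.
    by rewrite ler_pM2l ?exprn_gt0// ler_norm.
  rewrite ler_pM2l ?invr_gt0 ?exprn_gt0//; apply: (le_trans mside).
  by rewrite ler_eXnr// (le_trans m1).
pose x i := xget 0 (piece E L i).
(* Radius 0 for the numbers that are not used: such balls are empty and do not
   contribute to the sum. *)
pose r i := if `[< piece E L i !=set0 >] then n.+1%:R * side L (level E L (x i)) else 0.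
have r0 i : 0 <= r i.
  by rewrite /r; case: asboolP => // _; rewrite mulr_ge0// ltW// side_gt0.
have cover : E `<=` \bigcup_i eball (x i) (r i).
  rewrite -[X in X `<=` _](bigcup_piece E L) => y [i _ iy]; exists i => //.
  have ne : piece E L i !=set0 by exists y.
  have ix : piece E L i (x i) by apply: xgetPex; exact: ne.
  rewrite /eball /= /r; case: asboolP => // _.
  apply: (cube_enorm _ (x i)); [exact: side_gt0| |exact: cube_refl].
  by move: iy; rewrite (pieceE E L L0 oE _ _ ix) => -[].
apply: (@le_trans _ _ (\sum_(0 <= i <oo) (omega s * r i `^ s)%:E)%E).
  by apply: ereal_inf_lbound; exists x, r.
have -> : interaction p (E `*` ~` E) =
    (\sum_(0 <= i <oo) interaction p (piece E L i `*` ~` E))%E.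
  have EE : E `*` ~` E = \bigcup_i (piece E L i `*` ~` E).
    by rewrite -setX_bigcupl bigcup_piece.
  rewrite {1}EE /interaction ge0_integral_bigcup//.
  - move=> k; apply: measurableX; first exact: measurable_piece.
    exact: measurableC.
  - by apply/measurable_EFinP; apply: measurable_funTS; exact: measurable_kernel.
  - by move=> w _; rewrite lee_fin kernel_ge0.
  - apply/trivIsetP => i j _ _ ij; apply/seteqP; split => // w [[wi _] [wj _]].
    have /trivIsetP/(_ i j I I ij) PP := trivIset_piece E L.
    by have : (piece E L i `&` piece E L j) w.1 by []; rewrite PP.
rewrite -nneseriesZl; last first.
  by move=> i _; apply: integral_ge0 => w _; rewrite lee_fin kernel_ge0.
apply: lee_nneseries => [i _ _|i _].
  by rewrite lee_fin mulr_ge0// powR_ge0.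
rewrite /r; case: asboolP => [ne|_]; last first.
  rewrite powR0 ?gt_eqF// mulr0 mule_ge0//.
    rewrite lee_fin mulr_ge0//; last by rewrite mulr_ge0 ?subr_ge0// ltW.
    by rewrite divr_ge0 ?mulr_ge0 ?exprn_ge0// ltW.
  by apply: integral_ge0 => w _; rewrite lee_fin kernel_ge0.
have ix : piece E L i (x i) by apply: xgetPex; exact: ne.
have Ex : E (x i) by case: ix.
set l := side L _; have l0 : 0 < l by exact: side_gt0.
have := HN l (x i) E l0 mE _ _; rewrite -/s -/c -/p -(pieceE E L L0 oE _ _ ix).
have /asboolP dl := heavy_level E L L0 oE (x i) Ex.
rewrite {1}(pieceE E L L0 oE _ _ ix) => /(_ dl).
have cl k : (k < N)%N -> ((2^-1 * (2 ^+ k * l) ^+ n)%:E <=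
    mu (cube (2 ^+ k * l) (x i) `\` E))%E.
  by move=> kN; apply: level_ancestor_light => //; exact: ltn_trans (lvl _ Ex).
move=> /(_ cl) h.
set A := interaction _ _ in h *; set aa := alpha * (1 - alpha) in h *.
rewrite [X in (X * A)%E]EFinM -muleA.
apply: le_trans (lee_pmul _ _ (lexx _) h); rewrite ?lee_fin; last 2 first.
- by rewrite divr_ge0 ?mulr_ge0 ?exprn_ge0// ltW.
- by rewrite mulr_ge0 ?powR_ge0// ltW.
rewrite powRM// ?(ltW l0)//.
rewrite [W * _ / c * _](_ : _ = W * (n.+1%:R ^+ n * l `^ s)); last first.
  by field; rewrite gt_eqF.
apply: ler_pM => //; first by rewrite mulr_ge0 ?powR_ge0.
rewrite ler_wpM2r ?powR_ge0// powR_le_expr ?ler1n//.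
by rewrite /s gerBl ltW.
Qed.

End boxing_inequality.

(** * The normalizing constant of the content *)

Section omega_bound.
Local Open Scope classical_set_scope.
Context {R : realType}.

(** The alternative accounts for [Gamma] being defined by a real-valued integral,
which is null when the integral diverges.  For [x >= 1] the integrand is at least
[exp(-2)] on [[1, 2]]. *)
Lemma Gamma_ge (x : R) : 1 <= x -> Gamma x = 0 \/ expR (- 2) <= Gamma x.
Proof.
move=> x1; rewrite /Gamma /Rintegral; set I := (\int[_]_(t in _) _)%E.
have : ((expR (- 2))%:E <= I)%E.
  have <- : (\int[lebesgue_measure]_(t in `]0%R, +oo[)
      (expR (- 2) * \1_(`[1, 2] : set (measurableTypeR R)) t)%:E =
      (expR (- 2))%:E)%E.
    under eq_integral do rewrite EFinM.
    rewrite ge0_integralZl ?lee_fin ?expR_ge0//; last first.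
      by apply/measurable_EFinP; exact: measurable_indic.
    rewrite integral_indic// setIidl; last first.
      by move=> t /=; rewrite !in_itv/= andbT => /andP[t1 _]; exact: lt_le_trans t1.
    transitivity ((expR (- 2 : R))%:E * 1)%E; last by rewrite mule1.
    congr *%E; transitivity (@lebesgue_measure R `[1, 2]%classic) => //.
    by rewrite lebesgue_measure_itv/= lte_fin ltr1n -EFinB; congr EFin; lra.
  apply: ge0_le_integral_pointwise => t /=; rewrite in_itv/= andbT => t0.
    by rewrite lee_fin mulr_ge0 ?expR_ge0.
  rewrite lee_fin indicE; case: (boolP (_ \in _)) => [|_]; last first.
    by rewrite mulr0 mulr_ge0 ?powR_ge0 ?expR_ge0.
  rewrite inE /= in_itv/= mulr1 => /andP[t1 t2].
  rewrite -[leLHS]mul1r; apply: ler_pM => //; rewrite ?expR_ge0//; last first.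
    by rewrite ler_expR lerN2.
  by rewrite -[leLHS](powRr0 t) ler_powR// subr_ge0.
by case: I => [r| |] /=; rewrite ?lee_fin; [right|left|].
Qed.

(** When [Gamma] vanishes so does its inverse, and the bound persists. *)
Lemma omega_le (n : nat) (s : R) : 0 <= s <= n%:R ->
  0 <= omega s <= pi `^ (n%:R / 2) * expR 2.
Proof.
move=> /andP[s0 sn].
have p1 : 1 <= pi :> R by apply: le_trans (pi_ge2 R); rewrite ler1n.
have s1 : 1 <= s / 2 + 1 by rewrite lerDr divr_ge0.
rewrite /omega; have [->|G] := Gamma_ge _ s1.
  by rewrite invr0 mulr0 lexx mulr_ge0 ?powR_ge0 ?expR_ge0.
have G0 : 0 < Gamma (s / 2 + 1) by apply: lt_le_trans G; exact: expR_gt0.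
rewrite divr_ge0 ?powR_ge0 ?(ltW G0)//=.
apply: ler_pM; rewrite ?powR_ge0 ?invr_ge0 ?(ltW G0)//.
  by rewrite ler_powR// ler_pM2r.
by rewrite -[expR 2]invrK -expRN lef_pV2 ?posrE ?expR_gt0.
Qed.

End omega_bound.

(** * Integration over the levels *)

Section lebesgue_rV_prod_sigma_finite.
Local Open Scope classical_set_scope.
Context {R : realType} {n : nat}.
Local Notation V := 'rV[R]_n.
Local Notation mu := (lebesgue_rV R n).

HB.instance Definition _ := Measure.copy (@lebesgue_rV_prod R n) (mu \x mu)%E.

Let lebesgue_rV_prod_sigma_finite : sigma_finite [set: V * V] (@lebesgue_rV_prod R n).
Proof.
have /sigma_finiteP[F [TF ndF Foo]] := sigma_finiteT mu.
exists (fun k => F k `*` F k).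
  rewrite -[LHS]setXTT TF predeqE => -[x y]; split.
    move=> [/= [i _ Fx] [j _ Fy]]; exists (maxn i j) => //; split.
    - by move: x Fx; exact/subsetPset/ndF/leq_maxl.
    - by move: y Fy; exact/subsetPset/ndF/leq_maxr.
  by move=> [k _ []/= ? ?]; split; exists k.
move=> k; have [mF Fk] := Foo k; split; first exact: measurableX.
by rewrite lebesgue_rV_prod_setX// lte_mul_pinfty// ge0_fin_numE.
Qed.

HB.instance Definition _ := Measure_isSigmaFinite.Build _ _ _ (@lebesgue_rV_prod R n)
  lebesgue_rV_prod_sigma_finite.

End lebesgue_rV_prod_sigma_finite.

Section choquet.
Local Open Scope classical_set_scope.
Context {R : realType} {n : nat}.
Local Notation V := 'rV[R]_n.
Local Notation mu := (lebesgue_rV R n).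
Local Notation mu2 := (@lebesgue_rV_prod R n).
Local Notation leb := (@lebesgue_measure R).
Variable (u : V -> R).
Hypothesis cu : continuous u.

Let superlevel (t : R) : set V := [set x | t < `|u x|].

Lemma open_superlevel t : open (superlevel t).
Proof.
rewrite (_ : superlevel t = (fun x => `|u x|) @^-1` `]t, +oo[); last first.
  by apply/seteqP; split => x /=; rewrite in_itv/= andbT.
apply: open_comp; last exact: interval_open.
by move=> x _; apply: continuous_comp; [exact: cu|exact: norm_continuous].
Qed.

Let mu_u : measurable_fun setT (u : V -> measurableTypeR R).
Proof. exact: continuous_measurable_rV. Qed.

Lemma gagliardoE (alpha : R) :
  gagliardo alpha u =
  (\int[mu2]_w (`|u w.2 - u w.1| * kernel (alpha + n%:R) w)%:E)%E.
Proof.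
rewrite fubini_tonelli1//.
- apply/measurable_EFinP; apply: measurable_funM; last exact: measurable_kernel.
  apply: measurableT_comp; first exact: normr_measurable.
  apply: measurable_funB.
    by apply: measurableT_comp => //; exact: measurable_snd.
  by apply: measurableT_comp => //; exact: measurable_fst.
- by move=> w; rewrite lee_fin mulr_ge0 ?kernel_ge0.
Qed.

(** Gathering the pairs [(z, y)] with [z] inside and [y] outside a superlevel set,
for all levels at once, in a single measurable set lets Tonelli exchange the
integrals over levels and over pairs. *)
Definition crossing : set (measurableTypeR R * (V * V)) :=
  [set tw | [/\ 0 <= tw.1, tw.1 < `|u tw.2.1| & `|u tw.2.2| <= tw.1]].

Lemma measurable_crossing : measurable crossing.
Proof.
have m1 : measurable_fun setT (fun tw : measurableTypeR R * (V * V) => tw.1).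
  exact: measurable_fst.
have mn : measurable_fun setT (fun x : V => `|u x|).
  by apply: measurableT_comp => //; exact: normr_measurable.
have m21 : measurable_fun setT (fun tw : measurableTypeR R * (V * V) => `|u tw.2.1|).
  apply: (measurableT_comp mn).
  by apply: measurableT_comp; [exact: measurable_fst|exact: measurable_snd].
have m22 : measurable_fun setT (fun tw : measurableTypeR R * (V * V) => `|u tw.2.2|).
  apply: (measurableT_comp mn).
  by apply: measurableT_comp; [exact: measurable_snd|exact: measurable_snd].
have sb (b : measurableTypeR R * (V * V) -> bool) :
    measurable_fun setT b -> measurable [set tw | b tw].
  move=> mb; rewrite (_ : [set _ | _] = b @^-1` [set true]).
    by rewrite -[X in measurable X]setTI; exact: mb.
  by apply/seteqP; split => tw /=.
rewrite (_ : crossing = [set tw | 0 <= tw.1] `&`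
   ([set tw | tw.1 < `|u tw.2.1|] `&` [set tw | `|u tw.2.2| <= tw.1])); last first.
  by apply/seteqP; split => tw; [case|case=> ? []].
apply: measurableI.
  by apply: sb; apply: measurable_fun_ler => //; exact: measurable_cst.
apply: measurableI; first by apply: sb; exact: measurable_fun_ltr.
by apply: sb; exact: measurable_fun_ler.
Qed.

Let f (p : R) (tw : measurableTypeR R * (V * V)) : \bar R :=
  (\1_crossing tw * kernel p tw.2)%:E.

Let mf p : measurable_fun setT (f p).
Proof.
apply/measurable_EFinP; apply: measurable_funM.
  by apply: measurable_indic; exact: measurable_crossing.
by apply: measurableT_comp; [exact: measurable_kernel|exact: measurable_snd].
Qed.

Let f0 p tw : (0 <= f p tw)%E.
Proof. by rewrite lee_fin mulr_ge0 ?kernel_ge0// indicE. Qed.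

Let interaction_superlevel p t : 0 <= t ->
  interaction p (superlevel t `*` ~` superlevel t) = (\int[mu2]_w f p (t, w))%E.
Proof.
move=> t0; rewrite /interaction integral_mkcond; apply: eq_integral => w _.
rewrite patchE /f /= indicE.
have -> : ((t, w) \in crossing) = (w \in superlevel t `*` ~` superlevel t).
  apply/idP/idP; rewrite !inE => -[/=].
    by move=> _ h1 h2; split => //=; apply/negP; rewrite -leNgt.
  by move=> h1 /negP; rewrite -leNgt => h2.
by case: ifPn; rewrite ?mul1r ?mul0r.
Qed.

Lemma measurable_interaction_superlevel p :
  measurable_fun (`[0%R, +oo[%classic : set (measurableTypeR R))
    (fun t => interaction p (superlevel t `*` ~` superlevel t)).
Proof.
apply: (eq_measurable_fun (fun t => \int[mu2]_w f p (t, w))%E).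
  by move=> t; rewrite inE /= in_itv/= andbT => t0; rewrite interaction_superlevel.
apply: measurable_funTS.
exact: (measurable_fun_fubini_tonelli_F (m2 := mu2) (f p) (mf p) (f0 p)).
Qed.

(** After exchanging the integrals, a pair [(z, y)] is counted for the levels in
[[|u y|, |u z|[], an interval of length at most [|u y - u z|]. *)
Lemma coarea_ge (p : R) :
  (\int[leb]_(t in `[0%R, +oo[) interaction p (superlevel t `*` ~` superlevel t) <=
   \int[mu2]_w (`|u w.2 - u w.1| * kernel p w)%:E)%E.
Proof.
have -> : (\int[leb]_(t in `[0%R, +oo[) interaction p (superlevel t `*` ~` superlevel t) =
    \int[leb]_t \int[mu2]_w f p (t, w))%E.
  rewrite integral_mkcond; apply: eq_integral => t _; rewrite patchE.
  case: ifPn; rewrite ?inE ?notin_setE /= in_itv/= andbT => t0.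
    by rewrite interaction_superlevel.
  rewrite integral0_eq// => w _; rewrite /f indicE memNset ?mul0r//.
  by move=> [/= h _ _]; apply: t0.
rewrite (@fubini_tonelli _ _ _ _ _ leb mu2 (f p) (mf p) (f0 p)).
apply: ge0_le_integral_pointwise => [w _|w _]; first exact: integral_ge0.
pose I : set (measurableTypeR R) := `[`|u w.2|, `|u w.1|[%classic.
have crossI t : \1_crossing (t, w) = \1_I t :> R.
  rewrite !indicE; congr (_%:R); congr nat_of_bool.
  apply/idP/idP; rewrite !inE /I /= in_itv/=.
    by move=> [_ -> ->].
  by move=> /andP[h1 h2]; split => //=; apply: le_trans h1.
rewrite /f /=; under eq_integral do rewrite crossI EFinM.
rewrite ge0_integralZr ?lee_fin ?kernel_ge0//; last first.
  by apply/measurable_EFinP; apply: measurable_indic; exact: measurable_itv.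
rewrite EFinM; apply: lee_pmul => //.
- by apply: integral_ge0 => t _; rewrite lee_fin indicE.
- by rewrite lee_fin kernel_ge0.
rewrite integral_indic//=; last exact: measurable_itv.
rewrite setIT lebesgue_measure_itv/= lte_fin.
case: ifPn => // _.
by rewrite -EFinB lee_fin distrC; exact: lerB_dist.
Qed.

End choquet.

Theorem theorem1p3 (R : realType) (d : nat) (hd : (0 < d)%N) :
  exists C : R, 0 < C /\
    forall alpha : R, 0 < alpha < 1 ->
    forall phi : 'rV[R]_d -> R, smooth phi -> compact_support phi ->
      (choquet_integral (d%:R - alpha) phi
       <= (C * (alpha * (1 - alpha)))%:E * gagliardo alpha phi)%E.
Proof.
pose W : R := pi `^ (d%:R / 2) * expR 2.
have W0 : 0 < W by rewrite mulr_gt0 ?powR_gt0 ?expR_gt0 ?pi_gt0.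
pose C := W * d.+1%:R ^+ d / (4^-1 * cube_const (R:=R) (n:=d)).
have C0 : 0 < C.
  by apply: divr_gt0; apply: mulr_gt0; rewrite ?exprn_gt0 ?cube_const_gt0.
exists C; split => // alpha /[dup] alpha01 /andP[a0 a1] phi sphi cphi.
have cont : continuous phi by have [] := sphi [::].
have [M HM] := compact_lebesgue_lty _ cphi.
have sd : 0 <= d%:R - alpha <= d%:R.
  by rewrite subr_ge0 gerBl (ltW a0) andbT (le_trans (ltW a1))// ler1n.
have aa0 : 0 <= C * (alpha * (1 - alpha)).
  by apply: mulr_ge0; [exact: ltW|apply: mulr_ge0; rewrite ?subr_ge0 ltW].
pose E (t : R) := [set x : 'rV[R]_d | t < `|phi x|]%classic.
have oE t : open (E t) by exact: open_superlevel.
apply: (@le_trans _ _ (\int[lebesgue_measure]_(t in `[0%R, +oo[)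
    ((C * (alpha * (1 - alpha)))%:E *
      interaction (alpha + d%:R) (E t `*` ~` E t)))%E).
  apply: ge0_le_integral_pointwise => t; rewrite /= in_itv/= andbT => t0.
    apply/ereal_infP => _ [x [r [r0 _ ->]]]; apply: nneseries_ge0 => i _ _.
    by rewrite lee_fin mulr_ge0 ?powR_ge0//; have /andP[] := omega_le d _ sd.
  apply: (boxing alpha W M (E t) hd alpha01 (omega_le d _ sd) (oE t)).
  apply: HM; first exact: open_measurable_rV.
  apply: subset_trans (@subset_closure _ _) => x /= tx.
  by rewrite -normr_gt0 (le_lt_trans t0).
rewrite gagliardoE// ge0_integralZl ?lee_fin//.
- by apply: lee_wpmul2l; [rewrite lee_fin|exact: coarea_ge].
- exact: measurable_interaction_superlevel.
- by move=> t _; apply: integral_ge0 => w _; rewrite lee_fin kernel_ge0.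
Qed.
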